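(* Let $A=(A,d,\cdot\,)$ be a differential graded associative algebra over a field $\Bbbk$, with cohomology $H=H(A,d)$, and let $x_1,\ldots,x_n\in H$, $n\ge 2$, be an ordered list of homogeneous cohomology classes. Put $$\varepsilon:=(-1)^{\frac{(n+2)(n+1)}2+\sum_{i=1}^n(n+i)|x_i|}\in\{-1,+1\}.$$ Consider the following conditions. (i) $\langle x_u,\ldots,x_v\rangle=\{0\}$ for each subinterval $x_u,\ldots,x_v$ of $x_1,\ldots,x_n$ of length $\le n-1$. (ii) Every canonical product $\mu_k$ of $A$ vanishes at each subinterval $x_u,\ldots,x_v$ of $x_1,\ldots,x_n$ of length $k\le n-1$, i.e. $\mu_k(x_u,\ldots,x_v)=0$. (iii) $\big\{\varepsilon\cdot\mu_n(x_1,\ldots,x_n)\ \big|\ \mu_n \text{ is a canonical } n\text{-ary product of } A\big\}\subset\langle x_1,\ldots,x_n\rangle$. Then (i) $\Longrightarrow$ (ii) $\Longrightarrow$ (iii).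
   Context: All objects are over a field $\Bbbk$; complexes are cochain complexes (differentials of degree $+1$), possibly unbounded; $[a]$ denotes the cohomology class of a cocycle $a$; $\overline a:=(-1)^{|a|}a$. Koszul sign rule is used when evaluating tensor products of maps on elements. A subinterval of $x_1,\ldots,x_n$ of length $k\ge2$ is a sequence $x_u,\ldots,x_v$ of $k$ consecutive entries. Massey products. A defining system for $\langle x_1,\ldots,x_n\rangle$ is a scheme $D=\{a_{u,v}\in A\mid 1\le u\le v\le n\}$ of homogeneous elements with $|a_{u,v}|=\sum_{r=u}^v(|x_r|-1)+1$ such that each $a_{u,u}$ is a cocycle representing $x_u$ and, for each $1\le u<v\le n$ with $v-u\le n-2$, $$d a_{u,v}=\sum_{r=u}^{v-1}\overline a_{u,r}\cdot a_{r+1,v}.$$ It determines the cocycle $c(D):=\sum_{r=1}^{n-1}\overline a_{1,r}\cdot a_{r+1,n}\in A^{|x_1|+\cdots+|x_n|-n+2}$. The $n$-fold Massey product is $$\langle x_1,\ldots,x_n\rangle:=\{[c(D)]\mid D \text{ a defining system for } \langle x_1,\ldots,x_n\rangle\}\subset H^{|x_1|+\cdots+|x_n|-n+2},$$ and it is $\emptyset$ if there is no defining system. An $A_\infty$-algebra $(A,d,\mu_2,\mu_3,\ldots)$ is a cochain complex $(A,d)$ with linear maps $\mu_n:A^{\otimes n}\to A$ of degree $2-n$, $n\ge2$, such that for all $n\ge 2$ $$\delta(\mu_n)=\sum (-1)^{i(l+1)+n}\,\mu_k\big(\mathrm{id}^{\otimes (i-1)}\otimes\mu_l\otimes \mathrm{id}^{\otimes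 (k-i)}\big),$$ the sum over $k,l\ge2$, $k+l=n+1$, $1\le i\le k$, where $\delta(f)=d\circ f-(-1)^{|f|}f\circ d$. A dg algebra is viewed as the $A_\infty$-algebra with $\mu_2=\cdot$ and $\mu_n=0$ for $n\ge3$. An $A_\infty$-morphism $\vartheta_\infty=(\vartheta,\vartheta_2,\vartheta_3,\ldots):(A,d,\mu_2,\ldots)\to(B,d,\nu_2,\ldots)$ consists of a cochain map $\vartheta=\vartheta_1:A\to B$ and linear maps $\vartheta_n:A^{\otimes n}\to B$ of degree $1-n$, $n\ge2$, such that for all $n\ge2$ $$\delta(\vartheta_n)+\sum_{k\ge2,\ r_1+\cdots+r_k=n,\ r_j\ge1}(-1)^{\sum_{i<j}r_i(r_j+1)}\nu_k(\vartheta_{r_1}\otimes\cdots\otimes\vartheta_{r_k})=\vartheta\circ\mu_n-\sum(-1)^{i(l+1)+n}\vartheta_k\big(\mathrm{id}^{\otimes(i-1)}\otimes\mu_l\otimes\mathrm{id}^{\otimes(k-i)}\big),$$ the last sum over $k,l\ge2$, $k+l=n+1$, $1\le i\le k$. A canonical minimal model of a dg algebra $A$ is an $A_\infty$-structure $(H,0,\mu_2,\mu_3,\ldots)$ on $H=H(A,d)$ for which there exists an $A_\infty$-morphism $\psi_\infty=(\psi,\psi_2,\ldots):(H,0,\mu_2,\mu_3,\ldots)\to(A,d,\cdot\,,0,0,\ldots)$ with $[\psi(h)]=h$ for each $h\in H$. A canonical $n$-ary product ($n\ge2$) is the $n$th operation $\mu_n:H^{\otimes n}\to H$ of some canonical minimal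 model of $A$. *)

(* Defs.v *)
From HB Require Import structures.
From mathcomp Require Import all_boot all_order all_algebra.
From mathcomp Require Import boolp classical_sets.

Set Implicit Arguments.
Unset Strict Implicit.
Unset Printing Implicit Defensive.

Import GRing.Theory.

Local Open Scope classical_set_scope.
Local Open Scope ring_scope.

(* A Z-graded vector space is its total space V together with the subspaces
   G i of homogeneous elements of degree i, V being their internal direct sum.
   The degree of an element is always passed separately: 0 has every degree. *)
Record is_grading (K : fieldType) (V : lmodType K) (G : int -> set V) : Prop := {
  grading0 : forall i, G i 0;
  gradingP : forall i (c : K) a b, G i a -> G i b -> G i (c *: a + b);
  grading_span : forall v, exists s : seq int, exists f : int -> V,
    [/\ uniq s, forall i, G i (f i) & v = \sum_(i <- s) f i];
  grading_indep : forall (s : seq int) (f : int -> V),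
    uniq s -> (forall i, G i (f i)) -> \sum_(i <- s) f i = 0 ->
    forall i, i \in s -> f i = 0
}.

Record cochainComplex (K : fieldType) := CochainComplex {
  total :> lmodType K;
  gr : int -> set total;
  diff : {linear total -> total};
  grP : is_grading gr;
  diff_gr : forall i a, gr i a -> gr (i + 1) (diff a);
  diff_diff : forall a, diff (diff a) = 0
}.

Arguments gr {K} _ _ _.
Arguments diff {K _}.
Arguments diff_diff {K _}.

Section Cohomology.
Variables (K : fieldType) (C : cochainComplex K).

Definition is_cocycle : {pred C} := fun a => diff a == 0.

Lemma is_cocycle_closed : submod_closed is_cocycle.
Proof.
split=> [|c a b]; rewrite !unfold_in ?linear0 //.
by move=> /eqP da /eqP db; rewrite linearP da db scaler0 addr0.
Qed.
HB.instance Definition _ := GRing.isSubmodClosed.Build K C is_cocycle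
  is_cocycle_closed.

Record cocycle := Cocycle { cocycle_val : C; _ : cocycle_val \in is_cocycle }.
HB.instance Definition _ := [isSub for cocycle_val].
HB.instance Definition _ := [Choice of cocycle by <:].
HB.instance Definition _ := [SubChoice_isSubLmodule of cocycle by <:].

Definition is_coboundary : {pred cocycle} :=
  fun z => `[< exists b : C, val z = diff b >].

Lemma is_coboundary_linear : submod_closed is_coboundary.
Proof.
split=> [|c y z]; rewrite !unfold_in.
  by apply/asboolP; exists 0; rewrite !linear0.
move=> /asboolP[b yb] /asboolP[b' zb']; apply/asboolP.
by exists (c *: b + b'); rewrite linearP [LHS]linearP; congr (_ *: _ + _).
Qed.
Lemma is_coboundary_closed : zmod_closed is_coboundary.
Proof. exact: GRing.submod_closedB is_coboundary_linear. Qed.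
HB.instance Definition _ := GRing.isZmodClosed.Build cocycle is_coboundary
  is_coboundary_closed.

Definition cohom : Type := Quotient.quot is_coboundary.
HB.instance Definition _ := GRing.Zmodule.on cohom.

Definition cl (z : cocycle) : cohom := (\pi_(Quotient.quot is_coboundary) z)%qT.

Lemma cl_is_zmod_morphism : zmod_morphism cl.
Proof. exact: pi_is_zmod_morphism. Qed.
HB.instance Definition _ := GRing.isZmodMorphism.Build cocycle cohom cl
  cl_is_zmod_morphism.

Lemma cl_eq0 z : cl z = 0 <-> exists b : C, val z = diff b.
Proof.
rewrite -[0](raddf0 cl); split.
  by move/eqP; rewrite -Quotient.idealrBE subr0 => /asboolP.
by move=> h; apply/eqP; rewrite -Quotient.idealrBE subr0; apply/asboolP.
Qed.

Definition cohom_repr (h : cohom) : cocycle :=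
  repr (h : Quotient.quot is_coboundary).

Lemma cohom_reprK : cancel cohom_repr cl.
Proof. by move=> h; rewrite /cl reprK. Qed.

Definition cohom_scale (c : K) (h : cohom) : cohom := cl (c *: cohom_repr h).

Lemma cl_scale c z : cl (c *: z) = cohom_scale c (cl z).
Proof.
apply/eqP; rewrite -subr_eq0 -raddfB; apply/eqP/cl_eq0.
have /cl_eq0[b eb] : cl (z - cohom_repr (cl z)) = 0.
  by rewrite raddfB /= cohom_reprK subrr.
by exists (c *: b); rewrite -scalerBr [LHS]linearZ [RHS]linearZ; congr (_ *: _).
Qed.

Fact cohom_scaleA a b h :
  cohom_scale a (cohom_scale b h) = cohom_scale (a * b) h.
Proof. by rewrite -[h]cohom_reprK -!cl_scale scalerA. Qed.
Fact cohom_scale1 : left_id 1 cohom_scale.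
Proof. by move=> h; rewrite -[h]cohom_reprK -cl_scale scale1r. Qed.
Fact cohom_scaleDr : right_distributive cohom_scale +%R.
Proof.
move=> c h h'; rewrite -[h]cohom_reprK -[h']cohom_reprK -raddfD -!cl_scale.
by rewrite scalerDr raddfD.
Qed.
Fact cohom_scaleDl h : {morph cohom_scale^~ h : a b / a + b}.
Proof. by move=> a b; rewrite -[h]cohom_reprK -!cl_scale scalerDl raddfD. Qed.
HB.instance Definition _ := GRing.Zmodule_isLmodule.Build K cohom
  cohom_scaleA cohom_scale1 cohom_scaleDr cohom_scaleDl.

Fact cl_scalable : scalable cl. Proof. exact: cl_scale. Qed.
HB.instance Definition _ := GRing.isScalable.Build K cocycle cohom *:%R cl
  cl_scalable.

(* a is a cocycle and [a] = h *)
Definition represents (a : C) (h : cohom) : Prop :=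
  exists2 z : cocycle, val z = a & cl z = h.

Definition cohom_gr (i : int) : set cohom :=
  [set h | exists2 a, gr C i a & represents a h].

Lemma represents_val (z : cocycle) : represents (val z) (cl z).
Proof. by exists z. Qed.

Lemma sum_restrict (V : zmodType) (s u : seq int) (f : int -> V) :
  uniq s -> uniq u -> {subset s <= u} ->
  \sum_(i <- u) (if i \in s then f i else 0) = \sum_(i <- s) f i.
Proof.
move=> us uu su; rewrite -big_mkcond -big_filter; apply: perm_big.
apply: uniq_perm => //; first exact: filter_uniq.
by move=> i; rewrite mem_filter andb_idr // => /su.
Qed.

Lemma cohom_grading : is_grading cohom_gr.
Proof.
have [G0 GP Gs Gi] := grP C.
have shiftK (t : seq int) i : (i \in [seq j + 1 | j <- t]) = (i - 1 \in t).
  by rewrite -{1}[i](subrK 1) (mem_map (addIr (1 : int))).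
have shift_uniq (t : seq int) : uniq t -> uniq [seq j + 1 | j <- t].
  by move=> ut; rewrite (map_inj_uniq (addIr (1 : int))).
split.
- move=> i; exists 0; first exact: G0.
  by exists 0; rewrite ?linear0 // (raddf0 cl).
- move=> i c h h' [a Ga [z za zh]] [b Gb [z' zb zh']].
  exists (c *: a + b); first exact: GP.
  by exists (c *: z + z'); rewrite ?linearP /= -?za -?zb -?zh -?zh' ?linearP.
- move=> h; rewrite -[h]cohom_reprK; set z := cohom_repr h.
  have [s [f [us fG zE]]] := Gs (val z).
  have df0 : forall i, i \in s -> diff (f i) = 0.
    have dG j : gr C j (diff (f (j - 1))).
      by rewrite -{1}[j](subrK 1); apply: diff_gr.
    have sum0 : \sum_(j <- [seq i + 1 | i <- s]) diff (f (j - 1)) = 0.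
      rewrite big_map; under eq_bigr do rewrite addrK.
      by rewrite -raddf_sum -zE; apply/eqP; apply: (valP z).
    move=> i si; have := Gi _ _ (shift_uniq _ us) dG sum0 (i + 1).
    by rewrite shiftK addrK => /(_ si).
  have fz i : i \in s -> val (insubd (0 : cocycle) (f i)) = f i.
    by move=> si; rewrite insubdK //; apply/eqP; exact: df0.
  exists s, (fun i => if i \in s then cl (insubd 0 (f i)) else 0); split=> //.
    move=> i; case: ifP => si.
      by exists (f i) => //; exists (insubd 0 (f i)); rewrite ?fz.
    exists 0; first exact: G0.
    by exists 0; rewrite ?linear0 // (raddf0 cl).
  transitivity (\sum_(i <- s) cl (insubd 0 (f i))).
    rewrite -raddf_sum; congr cl; apply: val_inj.
    by rewrite zE [RHS]raddf_sum; apply: eq_big_seq => i /fz.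
  by apply: eq_big_seq => i ->.
- move=> s f us fG sum0 i si.
  have /boolp.choice[z zP] : forall j, exists z : cocycle,
      gr C j (val z) /\ cl z = f j.
    by move=> j; have [a Ga [z za zf]] := fG j; exists z; rewrite za.
  have /cl_eq0[w wE] : cl (\sum_(j <- s) z j) = 0.
    by rewrite raddf_sum -[RHS]sum0; apply: eq_bigr => j _; case: (zP j).
  have [t [g [ut gG gE]]] := Gs w.
  pose u := undup (s ++ [seq j + 1 | j <- t]).
  pose F j := (if j \in s then val (z j) else 0)
    - (if j \in [seq j + 1 | j <- t] then diff (g (j - 1)) else 0).
  have FG j : gr C j (F j).
    rewrite /F addrC -scaleN1r; apply: GP; case: ifP => // _.
      by rewrite -{1}[j](subrK 1); apply: diff_gr.
    by case: (zP j).
  have F0 : \sum_(j <- u) F j = 0.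
    rewrite sumrB !sum_restrict ?undup_uniq ?shift_uniq //; last 2 first.
    - by move=> j jt; rewrite mem_undup mem_cat jt orbT.
    - by move=> j js; rewrite mem_undup mem_cat js.
    rewrite big_map; under [X in _ - X]eq_bigr do rewrite addrK.
    apply/eqP; rewrite subr_eq0; apply/eqP.
    by rewrite -[RHS]raddf_sum -gE; apply: etrans wE; rewrite [RHS]raddf_sum.
  have := Gi u F (undup_uniq _) FG F0 i.
  rewrite mem_undup mem_cat si => /(_ isT); rewrite /F si => /eqP.
  rewrite subr_eq0 => /eqP zi; case: (zP i) => _ <-; apply/cl_eq0.
  rewrite zi; case: ifP => _; first by exists (g (i - 1)).
  by exists 0; rewrite linear0.
Qed.

Definition zero_diff : {linear cohom -> cohom} := \0.

Lemma zero_diff_gr i h : cohom_gr i h -> cohom_gr (i + 1) (zero_diff h).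
Proof. by move=> _; apply: grading0 cohom_grading _. Qed.

Lemma zero_diffK h : zero_diff (zero_diff h) = 0.
Proof. by []. Qed.

Definition cohomology : cochainComplex K :=
  CochainComplex cohom_grading zero_diff_gr zero_diffK.

End Cohomology.

(* No unit is required. *)
Record dgAlgebra (K : fieldType) := DgAlgebra {
  dg_complex :> cochainComplex K;
  dg_mul : dg_complex -> dg_complex -> dg_complex;
  dg_mul_linearl : forall c a a' b,
    dg_mul (c *: a + a') b = c *: dg_mul a b + dg_mul a' b;
  dg_mul_linearr : forall c a b b',
    dg_mul a (c *: b + b') = c *: dg_mul a b + dg_mul a b';
  dg_mul_gr : forall i j a b, gr dg_complex i a -> gr dg_complex j b ->
    gr dg_complex (i + j) (dg_mul a b);
  dg_mulA : associative dg_mul;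
  diff_dg_mul : forall i a b, gr dg_complex i a ->
    diff (dg_mul a b) = dg_mul (diff a) b + ((-1 : K) ^ i) *: dg_mul a (diff b)
}.

Arguments dg_mul {K _}.

(* A family of n-ary maps V^n -> W, one for each n, and its evaluation on a
   list, the arity being the length of the list. *)
Definition ops (V W : Type) := forall n : nat, n.-tuple V -> W.

Definition ev (V W : Type) (f : ops V W) (s : seq V) : W :=
  f (size s) (in_tuple s).

Lemma ev_tuple (V W : Type) (f : ops V W) n (t : n.-tuple V) : ev f t = f n t.
Proof.
case: t => s sP; have /eqP es := sP; case: _ / es in sP *.
by rewrite /ev; congr (f _ _); apply: val_inj.
Qed.

Definition tuple_set (V : Type) n (t : n.-tuple V) (i : 'I_n) (x : V) :=
  [tuple if j == i then x else tnth t j | j < n].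

Section AInfinity.
Variable K : fieldType.
Implicit Types C D : cochainComplex K.

Definition homogeneous C n (p : n.-tuple int) (t : n.-tuple C) : Prop :=
  forall i, gr C (tnth p i) (tnth t i).

(* Linear maps C^{\otimes n} -> D of degree m, as multilinear maps. *)
Definition multilinear_of_degree C D n (m : int) (f : n.-tuple C -> D) : Prop :=
  (forall (t : n.-tuple C) i (c : K) a b,
     f (tuple_set t i (c *: a + b)) =
     c *: f (tuple_set t i a) + f (tuple_set t i b)) /\
  (forall p t, homogeneous p t -> gr D (\sum_i tnth p i + m) (f t)).

(* Below, identities between linear maps on C^{\otimes n} are evaluated on
   homogeneous elements t_1 \otimes ... \otimes t_n of degrees p_1, ..., p_n,
   with the signs of the Koszul rule. *)

(* delta(f) = d f - (-1)^m f d, for f of degree m *)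
Definition delta C D n (m : int) (f : n.-tuple C -> D)
    (p : n.-tuple int) (t : n.-tuple C) : D :=
  diff (f t) - ((-1 : K) ^ m) *:
    \sum_(i < n) ((-1 : K) ^ (\sum_(q <- take i p) q)) *:
      f (tuple_set t i (diff (tnth t i))).

(* f_k (id^{\otimes (i-1)} \otimes mu_l \otimes id^{\otimes (k-i)}) without its
   Koszul sign; the arity k of f is the length of the resulting list. *)
Definition insert C D (f : ops C D) (mu : ops C C) (i l : nat) (s : seq C) : D :=
  ev f (take i.-1 s ++ ev mu (take l (drop i.-1 s)) :: drop (i.-1 + l) s).

Definition insert_sum C D (f : ops C D) (mu : ops C C) n
    (p : n.-tuple int) (t : n.-tuple C) : D :=
  \sum_(2 <= k < n) \sum_(2 <= l < n | (k + l == n.+1)%N) \sum_(1 <= i < k.+1)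
    ((-1 : K) ^ ((i * (l + 1) + n)%N%:Z
                 + (2 - l%:Z) * \sum_(q <- take i.-1 p) q)) *:
      insert f mu i l t.

Definition is_ainf_algebra C (mu : ops C C) : Prop :=
  forall n, (2 <= n)%N ->
    multilinear_of_degree (2 - n%:Z) (mu n) /\
    forall p t, homogeneous p t ->
      delta (2 - n%:Z) (mu n) p t = insert_sum mu mu p t.

(* The sum of (-1)^{sum_{i<j} r_i (r_j + 1)} nu_k (f_{r_1} \otimes ... \otimes
   f_{r_k}); reshape cuts a list into consecutive blocks of lengths
   r_1, ..., r_k, and 1 - r_j is the degree of f_{r_j}. *)
Definition compose_sum C D (nu : ops D D) (f : ops C D) n
    (p : n.-tuple int) (t : n.-tuple C) : D :=
  \sum_(2 <= k < n.+1)
  \sum_(r : k.-tuple 'I_n.+1 |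
        [forall j, (0 < tnth r j)%N] && (\sum_j tnth r j == n)%N)
    let sh := [seq val i | i <- r] in
    ((-1 : K) ^ (\sum_(j < k) \sum_(i < k | (i < j)%N)
        ((tnth r i * (tnth r j + 1))%N%:Z
         + (1 - (tnth r j)%:Z) * \sum_(q <- nth [::] (reshape sh p) i) q))) *:
      ev nu [seq ev f b | b <- reshape sh t].

Record is_ainf_morphism C D (mu : ops C C) (nu : ops D D) (f : ops C D) :
    Prop := {
  ainf_mor_mult : forall n, (1 <= n)%N ->
    multilinear_of_degree (1 - n%:Z) (f n);
  ainf_mor_cochain : forall a, diff (f 1%N [tuple a]) = f 1%N [tuple diff a];
  ainf_mor_rel : forall n (p : n.-tuple int) (t : n.-tuple C), (2 <= n)%N ->
    homogeneous p t ->
    delta (1 - n%:Z) (f n) p t + compose_sum nu f p t =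
    f 1%N [tuple mu n t] - insert_sum f mu p t
}.

End AInfinity.

Section MasseyAndCanonical.
Variables (K : fieldType) (A : dgAlgebra K).
Local Notation H := (cohomology A).

Definition dg_ops : ops A A :=
  fun n t => if n == 2%N then dg_mul t`_0 t`_1 else 0.

Definition is_canonical_minimal_model (mu : ops H H) : Prop :=
  is_ainf_algebra mu /\
  exists psi : ops H A, is_ainf_morphism mu dg_ops psi /\
    forall h : H, represents (psi 1%N [tuple h]) h.

Definition canonical_product n : set (n.-tuple H -> H) :=
  [set m | exists2 mu, is_canonical_minimal_model mu & m = mu n].

(* Indices start at 0 here: a u v stands for a_{u+1,v+1}, of degree
   massey_degree p u v, where p lists the degrees of the classes. *)
Definition massey_degree (p : seq int) (u v : nat) : int :=
  \sum_(u <= r < v.+1) (p`_r - 1) + 1.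

Definition massey_sum (p : seq int) (a : nat -> nat -> A) (u v : nat) : A :=
  \sum_(u <= r < v)
    dg_mul (((-1 : K) ^ massey_degree p u r) *: a u r) (a r.+1 v).

Record is_defining_system n (p : n.-tuple int) (x : n.-tuple H)
    (a : nat -> nat -> A) : Prop := {
  defsys_gr : forall u v, (u <= v < n)%N -> gr A (massey_degree p u v) (a u v);
  defsys_diag : forall u, (u < n)%N -> represents (a u u) x`_u;
  defsys_diff : forall u v, (u < v < n)%N -> (v - u <= n - 2)%N ->
    diff (a u v) = massey_sum p a u v
}.

(* Requiring the cocycle massey_sum p a 0 n.-1 to represent h adds no condition:
   it is closed for every defining system. *)
Definition massey n (p : n.-tuple int) (x : n.-tuple H) : set H :=
  [set h | exists2 a, is_defining_system p x a
                    & represents (massey_sum p a 0 n.-1) h].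

End MasseyAndCanonical.

Arguments dg_ops {K} A n _.
Arguments canonical_product {K} A n _.
Arguments massey {K A n} p x _.

(* The entries t_u, ..., t_{u+k-1} (indices from 0), for u + k <= n *)
Definition subinterval (V : nmodType) n (t : n.-tuple V) (u k : nat) : k.-tuple V :=
  [tuple t`_(u + i) | i < k].

(* Main.v *)
(** Let [psi] be an A-infinity morphism from a canonical minimal model [mu] to
    [A], and suppose that [mu] vanishes at all proper subintervals of
    [x_1, ..., x_n].  The insertion terms of the morphism relation at
    [x_1, ..., x_n] and at its subintervals then vanish, so that, up to signs,
    [psi_{v-u+1}(x_u, ..., x_v)] is a defining system whose cocycle differs from
    [eps psi_1(mu_n(x_1, ..., x_n))] by a coboundary.  This gives (ii) => (iii);
    applied to longer and longer subintervals it gives (i) => (ii), since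
    [eps mu_k] then lies in a Massey product equal to [{0}]. *)

Require Import Defs.
From mathcomp Require Import all_boot all_order all_algebra.
From mathcomp Require Import boolp classical_sets.
From mathcomp Require Import zify ring.

Import GRing.Theory.

Local Open Scope classical_set_scope.
Local Open Scope ring_scope.

(** * Morphisms into a dg algebra: the quadratic composition terms *)

Lemma dg_ops_eq0 (K : fieldType) (A : dgAlgebra K) (s : seq A) :
  size s != 2%N -> ev (dg_ops A) s = 0.
Proof. by rewrite /ev /dg_ops => /negPf ->. Qed.

(** Only the binary operation of [dg_ops A] is nonzero, so only [k = 2] contributes, and a
    composition of [n] into two positive parts is determined by its first part [m]. *)
Lemma compose_sum_dg (K : fieldType) (A : dgAlgebra K) (C : cochainComplex K)
    (f : ops C A) n (p : n.-tuple int) (t : n.-tuple C) :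
  compose_sum (dg_ops A) f p t =
  \sum_(1 <= m < n)
    ((-1 : K) ^ ((m * (n - m + 1))%N%:Z
                 + (1 - (n - m)%N%:Z) * \sum_(q <- take m p) q)) *:
      dg_mul (ev f (take m t)) (ev f (drop m t)).
Proof.
have [n1|n2] := leqP n 1.
  by rewrite /compose_sum !big_geq.
rewrite /compose_sum big_ltn // [X in _ + X]big_nat_cond [X in _ + X]big1; last first.
  move=> k /andP[/andP[k2 _] _]; rewrite big1 // => r _ /=.
  rewrite dg_ops_eq0 ?scaler0 // size_map size_reshape size_map size_tuple.
  by rewrite gtn_eqF.
rewrite addr0.
rewrite (reindex_onto (fun m : 'I_n.+1 => [tuple m; inord (n - m)])
                      (fun r => thead r)); last first.
  move=> r /andP[_]; rewrite big_ord_recl big_ord1 => /eqP rn.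
  apply: val_inj; case/tupleP: r rn => a r; case/tupleP: r => b r.
  rewrite (tuple0 r) /= !tnthS !tnth0 => rn.
  congr [:: _; _]; apply: val_inj; rewrite /= inordK theadE; lia.
rewrite (big_nat_widenl 1 0) // (big_nat_widen 0 n n.+1) // big_mkord.
apply: eq_big => [m|m /andP[/andP[_ /eqP mn] _]].
  rewrite theadE eqxx andbT big_ord_recl big_ord1 tnthS !tnth0.
  rewrite inordK ?ltnS ?leq_subr //.
  apply/andP/andP => [[/forallP m_gt0 /eqP mn]|[m_gt0 m_ltn]].
    have := m_gt0 0; have := m_gt0 1; rewrite /= /tnth /= inordK ?ltnS ?leq_subr //.
    lia.
  split; last by apply/eqP; lia.
  apply/forallP => i; rewrite (tnth_nth ord0).
  by case: i => [[|[|i]] // i_lt2] /=; rewrite ?inordK; lia.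
have bE : (inord (n - m) : 'I_n.+1) = (n - m)%N :> nat
  by rewrite inordK // ltnS leq_subr.
(* The sign involves only the pair [i = 0 < j = 1]: the inner sum is empty for [j = 0] and has one
   term for [j = 1]. *)
rewrite big_ord_recl big_ord1 big_pred0 // add0r.
rewrite (big_pred1 ord0) => [|i]; last by case: i => [[|[|i]]].
rewrite tnthS !tnth0 /= bE.
have takeE T (s : n.-tuple T) : take (n - m) (drop m s) = drop m s.
  by rewrite take_oversize // size_drop size_tuple.
by rewrite takeE [ev (dg_ops A) _]/=.
Qed.

(** * Cutting tuples into subintervals *)

Lemma take_drop_subinterval (V : nmodType) n (t : n.-tuple V) u k :
  (u + k <= n)%N -> take k (drop u t) = subinterval t u k.
Proof.
move=> uk; apply: (@eq_from_nth _ 0) => [|i].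
  by rewrite size_take_min size_drop !size_tuple; lia.
rewrite size_take_min size_drop size_tuple leq_min => /andP[i_ltk _].
by rewrite nth_take // nth_drop -(tnth_nth _ _ (Ordinal i_ltk)) tnth_mktuple.
Qed.

Lemma nth_subinterval (V : nmodType) n (t : n.-tuple V) u k i :
  (i < k)%N -> (subinterval t u k)`_i = t`_(u + i).
Proof. by move=> ik; rewrite -(tnth_nth _ _ (Ordinal ik)) tnth_mktuple. Qed.

Lemma subinterval_subinterval (V : nmodType) n (t : n.-tuple V) u k v l :
  (v + l <= k)%N ->
  subinterval (subinterval t u k) v l = subinterval t (u + v) l.
Proof.
move=> vl; apply: eq_from_tnth => i; rewrite !tnth_mktuple nth_subinterval.
  by rewrite addnA.
by have := ltn_ord i; lia.
Qed.

Lemma take_subinterval (V : nmodType) n (t : n.-tuple V) u k l :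
  (l <= k)%N -> take l (subinterval t u k) = subinterval t u l.
Proof.
by move=> lk; rewrite -{1}[u]addn0 -[X in take l X]drop0 take_drop_subinterval //
  subinterval_subinterval // !addn0.
Qed.

Lemma drop_subinterval (V : nmodType) n (t : n.-tuple V) u k l :
  (l <= k)%N -> drop l (subinterval t u k) = subinterval t (u + l) (k - l).
Proof.
move=> lk; rewrite -[LHS](@take_oversize _ (k - l)).
  by rewrite take_drop_subinterval ?subnKC // subinterval_subinterval ?subnKC.
by rewrite size_drop size_tuple.
Qed.

Lemma subinterval_full (V : nmodType) n (t : n.-tuple V) : subinterval t 0 n = t.
Proof. by apply: eq_from_tnth => i; rewrite tnth_mktuple (tnth_nth 0). Qed.

Lemma homogeneous_subinterval (K : fieldType) (C : cochainComplex K) n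
    (p : n.-tuple int) (t : n.-tuple C) u k :
  (u + k <= n)%N -> homogeneous p t ->
  homogeneous (subinterval p u k) (subinterval t u k).
Proof.
move=> uk pt i; rewrite !tnth_mktuple.
have uin : (u + i < n)%N by have := ltn_ord i; lia.
by have := pt (Ordinal uin); rewrite !(tnth_nth 0).
Qed.

(** * Vanishing of terms with a zero argument *)

Section Multilinear.
Variables (K : fieldType) (C D : cochainComplex K).

Lemma multilinear_eq0 n m (f : n.-tuple C -> D) (t : n.-tuple C) i :
  multilinear_of_degree m f -> tnth t i = 0 -> f t = 0.
Proof.
move=> [fL _] ti0.
have tE : tuple_set t i 0 = t.
  by apply: eq_from_tnth => j; rewrite tnth_mktuple; case: eqP => // ->.
have := fL t i 1 0 0; rewrite scaler0 addr0 scale1r tE => /eqP.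
by rewrite -subr_eq0 opprD addrA subrr sub0r oppr_eq0 => /eqP.
Qed.

Lemma ev_eq0 (f : ops C D) (deg : nat -> int) (s : seq C) :
  (forall n, (1 <= n)%N -> multilinear_of_degree (deg n) (f n)) ->
  0 \in s -> ev f s = 0.
Proof.
move=> fL s0; have := s0; rewrite -index_mem => i_lt.
apply: (multilinear_eq0 _ _ _ _ (Ordinal i_lt) (fL _ _)).
  by apply: leq_trans i_lt.
by rewrite (tnth_nth 0) /= nth_index.
Qed.

(** Since [k >= 2] and [k + l = n + 1], the inner operation always acts on a proper subinterval; its
    value 0 then becomes an argument of the multilinear [f k]. *)
Lemma insert_sum_eq0 (f : ops C D) (mu : ops C C) (deg : nat -> int) n
    (p : n.-tuple int) (t : n.-tuple C) :
  (forall k, (1 <= k)%N -> multilinear_of_degree (deg k) (f k)) ->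
  (forall u l, (2 <= l < n)%N -> (u + l <= n)%N ->
     mu l (subinterval t u l) = 0) ->
  insert_sum f mu p t = 0.
Proof.
move=> fL mu0; rewrite /insert_sum big_nat big1 // => k /andP[k2 kn].
rewrite big_nat_cond big1 // => l /andP[/andP[l2 ln] /eqP kl].
rewrite big_nat big1 // => i /andP[i1 ik].
rewrite /insert take_drop_subinterval; last by lia.
rewrite [ev mu _]ev_tuple mu0; [|lia|lia].
rewrite (ev_eq0 _ _ _ fL) ?scaler0 //.
by rewrite mem_cat inE eqxx orbT.
Qed.

Lemma delta_diff0 n m (f : n.-tuple C -> D) (p : n.-tuple int)
    (t : n.-tuple C) :
  (forall c : C, diff c = 0) -> multilinear_of_degree m f ->
  delta m f p t = diff (f t).
Proof.
move=> d0 fL; rewrite /delta big1 ?scaler0 ?subr0 // => i _.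
rewrite (multilinear_eq0 _ _ _ _ i fL) ?scaler0 //.
by rewrite tnth_mktuple eqxx d0.
Qed.

End Multilinear.

Section Represents.
Variables (K : fieldType) (C : cochainComplex K).

Lemma representsZ (c : K) (a : C) (h : cohomology C) :
  represents a h -> represents (c *: a) (c *: h).
Proof. by case=> z <- <-; exists (c *: z); rewrite ?linearZ. Qed.

Lemma represents_subdiff (a b : C) (h : cohomology C) :
  represents a h -> represents (a - diff b) h.
Proof.
have db : diff b \in @is_cocycle K C by apply/eqP; rewrite diff_diff.
have /cl_eq0 db0 : exists c, val (Cocycle db) = diff c by exists b.
by case=> z <- <-; exists (z - Cocycle db); rewrite // raddfB /= db0 subr0.
Qed.

End Represents.

(** * Signs and scalars in products *)

Lemma exprN1_even (K : fieldType) (e c : int) :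
  (-1 : K) ^ (e + 2 * c) = (-1) ^ e.
Proof.
have N1_neq0 : (-1 : K) != 0 by rewrite oppr_eq0 oner_eq0.
by rewrite expfzDr // -exprz_exp -[(-1) ^ 2]/((-1) ^+ 2) sqrrN expr1n exp1rz mulr1.
Qed.

Section DgMul.
Variables (K : fieldType) (A : dgAlgebra K).

Lemma dg_mulZl c (a b : A) : dg_mul (c *: a) b = c *: dg_mul a b.
Proof.
have mul0 : dg_mul 0 b = 0 :> A.
  by have := dg_mul_linearl (-1) 0 0 b; rewrite scaler0 addr0 scaleN1r addNr.
by have := dg_mul_linearl c a 0 b; rewrite mul0 !addr0.
Qed.

Lemma dg_mulZr c (a b : A) : dg_mul a (c *: b) = c *: dg_mul a b.
Proof.
have mul0 : dg_mul a 0 = 0 :> A.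
  by have := dg_mul_linearr (-1) a 0 0; rewrite scaler0 addr0 scaleN1r addNr.
by have := dg_mul_linearr c a b 0; rewrite mul0 !addr0.
Qed.

End DgMul.

Lemma massey_degreeE (p : seq int) u m :
  massey_degree p u (u + m) = \sum_(i < m.+1) p`_(u + i) - m%:Z.
Proof.
rewrite /massey_degree -{1}[u]add0n big_addn subSn ?leq_addr // addKn big_mkord.
rewrite sumrB sumr_const card_ord -[1 *+ _]/(m.+1%:R) natz intS.
under eq_bigr do rewrite addnC.
ring.
Qed.

(* The signs solve [s(m+b) (-1)^(m(b+1) + (1-b)P) = - (-1)^(P-m+1) s(m) s(b)],
   where [P] is the sum of the first [m] degrees, normalised by [s(1) = 1];
   then [eps = - s(n)]. *)
Definition massey_sign_exp (p : seq int) (u k : nat) : int :=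
  (((k + 2) * (k + 1)) %/ 2)%N%:Z + 1
  + \sum_(i < k) (k + i.+1)%N%:Z * p`_(u + i).

(** The sign rule for gluing adjacent blocks of lengths [m] and [b], as a congruence mod 2. The
    triangular numbers produce the cross term [m * b], and the weighted degree sum splits at
    position [m]. *)
Lemma massey_sign_expD (p : seq int) u m b : exists c : int,
  massey_sign_exp p u (m + b) + 1
    + ((m * (b + 1))%N%:Z + (1 - b%:Z) * \sum_(i < m) p`_(u + i)) =
  \sum_(i < m) p`_(u + i) - m%:Z + 1
    + massey_sign_exp p u m + massey_sign_exp p (u + m) b + 2 * c.
Proof.
set P := \sum_(i < m) p`_(u + i).
pose Q := \sum_(i < b) p`_(u + m + i).
pose W v k := \sum_(i < k) i.+1%:Z * p`_(v + i).
have WE v k l : \sum_(i < k) (l + i.+1)%N%:Z * p`_(v + i) =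
    l%:Z * \sum_(i < k) p`_(v + i) + W v k.
  by rewrite mulr_sumr -big_split; apply: eq_bigr => i _; rewrite PoszD mulrDl.
pose T k := (((k + 2) * (k + 1)) %/ 2)%N.
have TD : (T (m + b) + 1 = T m + T b + m * b)%N.
  have T2 k : ((k + 2) * (k + 1) = T k * 2)%N.
    by rewrite divnK // dvdn2 oddM !oddD /=; case: odd.
  have := T2 m; have := T2 b; have := T2 (m + b)%N; lia.
(* Half the difference of the two sides: the [P] terms cancel, while [Q] has coefficient [2m + b] on
   the left and [b] on the right. *)
exists (m%:Z * b%:Z + m%:Z + m%:Z * Q - 1).
rewrite /massey_sign_exp big_split_ord /= !WE.
have -> : \sum_(i < b) (m + b + (m + i).+1)%N%:Z * p`_(u + (m + i)) =
    (m + b + m)%N%:Z * Q + W (u + m)%N b.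
  by rewrite -WE; apply: eq_bigr => i _; rewrite addnA -addnS !addnA.
rewrite -/P -/Q -!/(T _).
have -> : (T (m + b))%:Z = (T m)%:Z + (T b)%:Z + m%:Z * b%:Z - 1.
  by rewrite -PoszM -!PoszD -TD PoszD addrK.
rewrite !PoszD !PoszM !PoszD; ring.
Qed.

(** * The defining system built from a morphism *)

Section MasseyOfMorphism.
Variables (K : fieldType) (A : dgAlgebra K).
Local Notation H := (cohomology A).

Definition massey_system (psi : ops H A) n (p : n.-tuple int) (x : n.-tuple H)
    (u v : nat) : A :=
  ((-1 : K) ^ massey_sign_exp p u (v.+1 - u)) *:
    psi (v.+1 - u)%N (subinterval x u (v.+1 - u)).

(** Both sums run over the ways to cut the interval into two blocks; the summands agree up to sign,
    and [massey_sign_expD] makes the sign discrepancy the same for every cut. *)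
Lemma massey_sum_system (psi : ops H A) n (p : n.-tuple int) (x : n.-tuple H)
    u k :
  massey_sum p (massey_system psi n p x) u (u + k) =
  - ((-1) ^ massey_sign_exp p u k.+1) *:
    compose_sum (dg_ops A) psi (subinterval p u k.+1) (subinterval x u k.+1).
Proof.
rewrite compose_sum_dg scaler_sumr /massey_sum -{1}[u]add0n big_addn addKn.
rewrite big_add1 /= !big_nat; apply: eq_bigr => i /andP[_ ik].
rewrite [(i + u)%N]addnC massey_degreeE /massey_system.
have -> : ((u + i).+1 - u = i.+1)%N by lia.
have -> : ((u + k).+1 - (u + i).+1 = k.+1 - i.+1)%N by lia.
rewrite !take_subinterval ?drop_subinterval; try by lia.
rewrite !ev_tuple addnS.
rewrite !dg_mulZl dg_mulZr !scalerA; congr (_ *: _).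
have N1_neq0 : (-1 : K) != 0 by rewrite oppr_eq0 oner_eq0.
have [c] := massey_sign_expD p u i.+1 (k.+1 - i.+1).
rewrite subnKC ?addnS; last by lia.
move=> ec.
(* Writing the minus sign as [(-1) ^ 1] turns each side into a single power of -1, so that only
   exponents have to be compared. *)
rewrite -[- (-1) ^ _]mulrN1 -[X in _ = _ * X * _]expr1z -!expfzDr //.
rewrite big_tuple.
under [in RHS]eq_bigr do rewrite tnth_mktuple.
rewrite ec exprN1_even; congr (_ ^ _).
  by rewrite intS; ring.
by rewrite addnS.
Qed.

(** This serves both implications: at the full list for (ii) => (iii), and at each subinterval in
    the induction for (i) => (ii). *)
Lemma canonical_product_massey n (p : n.-tuple int) (x : n.-tuple H)
    (mu : ops H H) :
  (2 <= n)%N -> homogeneous p x -> is_canonical_minimal_model mu ->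
  (forall u k, (2 <= k < n)%N -> (u + k <= n)%N ->
     mu k (subinterval x u k) = 0) ->
  massey p x (- ((-1 : K) ^ massey_sign_exp p 0 n) *: mu n x).
Proof.
case: n p x => [|[|n]] // p x _ px [_ [psi [[psiL _ psi_rel] psi_rep]]] mu0.
(* The morphism relation on one block, solved for the quadratic terms. On a proper block the [mu]
   term vanishes, which gives the defining equation; on the whole list it gives the class of the
   Massey cocycle. *)
have rel u k : (u + k.+2 <= n.+2)%N ->
    massey_sum p (massey_system psi n.+2 p x) u (u + k.+1) =
    - ((-1) ^ massey_sign_exp p u k.+2) *:
      (psi 1%N [tuple mu k.+2 (subinterval x u k.+2)]
       - diff (psi k.+2 (subinterval x u k.+2))).
  move=> uk; rewrite massey_sum_system; congr (_ *: _).
  have := psi_rel k.+2 _ _ isT (homogeneous_subinterval _ _ _ _ _ u k.+2 uk px).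
  rewrite delta_diff0 //; last exact: psiL.
  rewrite (insert_sum_eq0 _ _ _ _ _ _ _ _ _ psiL) ?subr0; last first.
    move=> v l l_lt vl; rewrite subinterval_subinterval //; apply: mu0; lia.
  by move=> <-; rewrite addrC addKr.
have psi1_0 : psi 1%N [tuple 0] = 0.
  apply: (multilinear_eq0 _ _ _ _ _ _ [tuple 0] ord0 (psiL 1%N isT)).
  by rewrite tnth0.
exists (massey_system psi n.+2 p x).
  split.
  - move=> u v /andP[uv vn]; rewrite -(subnKC uv) massey_degreeE /massey_system.
    have -> : ((u + (v - u)).+1 - u = (v - u).+1)%N by lia.
    set k := (v - u)%N; have uk : (u + k.+1 <= n.+2)%N by lia.
    (* Adding 0 brings the scalar multiple into the form [c *: a + b] of the grading axiom. *)
    have [_ GP _ _] := grP A; rewrite -[X in gr _ _ X]addr0.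
    apply: GP; last exact: grading0 (grP A) _.
    have := (psiL k.+1 isT).2 _ _ (homogeneous_subinterval _ _ _ _ _ _ _ uk px).
    under eq_bigr do rewrite tnth_mktuple.
    by rewrite intS opprD [1 + _]addrA subrr add0r.
  - move=> u un; rewrite /massey_system subSnn.
    (* For length 1 the exponent is [3 + 1 + 2 * p_u], hence even, and the diagonal entry is exactly
       [psi_1(x_u)]. *)
    have -> : massey_sign_exp p u 1 = 0 + 2 * (2 + p`_u).
      by rewrite /massey_sign_exp big_ord1 addn0 /=; lia.
    rewrite exprN1_even expr0z scale1r.
    suff -> : subinterval x u 1 = [tuple x`_u] by [].
    by apply: eq_from_tnth => i; rewrite tnth_mktuple ord1 addn0.
  - move=> u v /andP[uv vn] vu; have [k kE] : exists k, (v = u + k.+1)%N.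
      by exists (v - u).-1; lia.
    rewrite kE rel; last by lia.
    (* The bound [v - u <= n - 2] of a defining system says precisely that the block is proper, so
       [mu] vanishes on it. *)
    rewrite mu0; [|lia|lia].
    rewrite psi1_0 sub0r scalerN scaleNr opprK linearZ /massey_system.
    by have -> : ((u + k.+1).+1 - u = k.+2)%N by lia.
rewrite -[_.-1]/(0 + n.+1)%N rel // subinterval_full.
by apply/representsZ/represents_subdiff/psi_rep.
Qed.

End MasseyOfMorphism.

Theorem theorem11 (K : fieldType) (A : dgAlgebra K) (n : nat) (hn : (2 <= n)%N)
    (x : n.-tuple (cohomology A)) (p : n.-tuple int) (hx : homogeneous p x) :
  let eps : K :=
    (-1) ^ ((((n + 2) * (n + 1)) %/ 2)%N%:Z
            + \sum_(i < n) (n + i.+1)%N%:Z * tnth p i) in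
  let cond_i := forall u k : nat, (2 <= k <= n - 1)%N -> (u + k <= n)%N ->
    massey (subinterval p u k) (subinterval x u k) = [set 0] in
  let cond_ii := forall u k : nat, (2 <= k <= n - 1)%N -> (u + k <= n)%N ->
    forall mu_k, canonical_product A k mu_k -> mu_k (subinterval x u k) = 0 in
  let cond_iii :=
    [set eps *: mu_n x | mu_n in canonical_product A n]
      `<=` massey p x in
  (cond_i -> cond_ii) /\ (cond_ii -> cond_iii).
Proof.
move=> eps cond_i cond_ii cond_iii.
have sign_eps k (q : k.-tuple int) :
    - ((-1 : K) ^ massey_sign_exp q 0 k) =
    (-1) ^ ((((k + 2) * (k + 1)) %/ 2)%N%:Z
            + \sum_(i < k) (k + i.+1)%N%:Z * tnth q i).
  have N1_neq0 : (-1 : K) != 0 by rewrite oppr_eq0 oner_eq0.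
  rewrite /massey_sign_exp addrAC [in LHS]expfzDr // expr1z mulrN1 opprK.
  by congr (_ ^ (_ + _)); apply: eq_bigr => i _; rewrite add0n -tnth_nth.
split=> [ci | cii h [mu_n [mu mu_model ->] <-]]; last first.
  rewrite /eps -sign_eps; apply: canonical_product_massey => // u k kn uk.
  by apply: cii => //; [lia | exists mu].
(* Strong induction on the length, for all starting points at once, since a block contains shorter
   blocks starting anywhere inside it. *)
move=> u k; elim/ltn_ind: k u => k IH u k2n uk _ [mu mu_model ->].
have k2 : (2 <= k)%N by case/andP: k2n.
have : massey (subinterval p u k) (subinterval x u k)
    (- ((-1 : K) ^ massey_sign_exp (subinterval p u k) 0 k)
       *: mu k (subinterval x u k)).
  apply: canonical_product_massey => //; first exact: homogeneous_subinterval.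
  move=> v l lk vl; rewrite subinterval_subinterval //.
  by apply: IH; [lia | lia | lia | exists mu].
(* By (i) the signed product is 0, and the sign is a nonzero scalar. *)
rewrite ci // => /eqP; rewrite scaler_eq0 oppr_eq0 expfz_eq0 oppr_eq0 oner_eq0.
by rewrite andbF => /eqP.
Qed.
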